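(* Fix a layer $l\ge2$ and a unit $i\ge1$. If $\phi:\mathbb{R}\to\mathbb{R}$ is Lipschitz on $\mathbb{R}$, then the network processes $f_i^{(l)}(1),f_i^{(l)}(2),\dots$ are $\mathbb{P}$-a.s. Lipschitz on $\mathbb{R}^I$, while the limiting process $f_i^{(l)}$ (up to passing to a continuous version) is $\mathbb{P}$-a.s. continuous on $\mathbb{R}^I$ and locally $\gamma$-H\''older continuous for each $0<\gamma<1$.
   Context: Fix $I\in\mathbb{N}$ and $\sigma_\omega^2,\sigma_b^2>0$. On a probability space $(\Omega,\mathcal{H},\mathbb{P})$ let $\omega_{i,j}^{(l)}$ ($i,j,l\ge 1$, with $1\le j\le I$ when $l=1$) be i.i.d. $N(0,\sigma_\omega^2)$ weights and $b_i^{(l)}$ ($i,l\ge1$) i.i.d. $N(0,\sigma_b^2)$ biases, with weights independent of biases. Let $\phi:\mathbb{R}\to\mathbb{R}$ be continuous. Network process: for $x\in\mathbb{R}^I$, $i\ge1$ and $n\ge1$, $$f_i^{(1)}(x,n)=f_i^{(1)}(x)=\sum_{j=1}^I\omega_{i,j}^{(1)}x_j+b_i^{(1)},\qquad f_i^{(l)}(x,n)=\frac1{\sqrt n}\sum_{j=1}^n\omega_{i,j}^{(l)}\,\phi\big(f_j^{(l-1)}(x,n)\big)+b_i^{(l)}\quad(l\ge2),$$ and $f_i^{(l)}(n)$ denotes the stochastic process $x\mapsto f_i^{(l)}(x,n)$ on $\mathbb{R}^I$. ''$\mathbb{P}$-a.s. Lipschitz'' means that there is a (finite, width-dependent) random variable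 $H$ such that, $\mathbb{P}$-a.s., $|f_i^{(l)}(x,n)-f_i^{(l)}(y,n)|\le H\|x-y\|_{\mathbb{R}^I}$ for all $x,y\in\mathbb{R}^I$. Limiting process: $f_i^{(l)}$ is the centered Gaussian process on $\mathbb{R}^I$ with $(f_i^{(l)}(x^{(1)}),\dots,f_i^{(l)}(x^{(k)}))\sim N_k(\mathbf 0,\Sigma(l))$ for all $x^{(1)},\dots,x^{(k)}\in\mathbb{R}^I$, where $\Sigma(1)_{r,s}=\sigma_b^2+\sigma_\omega^2\langle x^{(r)},x^{(s)}\rangle_{\mathbb{R}^I}$ and, for $l\ge2$, $\Sigma(l)_{r,s}=\sigma_b^2+\sigma_\omega^2\int\phi(u_r)\phi(u_s)\,q^{(l-1)}(\mathrm{d}u)$ with $q^{(l-1)}=N_k(\mathbf 0,\Sigma(l-1))$. A version of a process $Z$ on $\mathbb{R}^I$ is a process $\tilde Z$ with $\mathbb{P}(\tilde Z(x)=Z(x))=1$ for each $x$. Locally $\gamma$-H\''older continuous means $\gamma$-H\''older continuous on every bounded subset of $\mathbb{R}^I$ (with a constant that may depend on the subset and on the path). *)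

(* Defs.v *)
From HB Require Import structures.
From mathcomp Require Import all_boot all_order all_algebra.
From mathcomp Require Import all_classical all_reals all_analysis.
From mathcomp Require Import measurable_realfun.

Set Implicit Arguments.
Unset Strict Implicit.
Unset Printing Implicit Defensive.

Import Order.TTheory GRing.Theory Num.Theory.
Import numFieldNormedType.Exports.

Local Open Scope classical_set_scope.
Local Open Scope ring_scope.

Section euclidean.
Context {R : realType} {I : nat}.

Definition dot (x y : 'rV[R]_I) : R := \sum_(j < I) x 0 j * y 0 j.

(* The library norm on ['rV[R]_I] is the sup norm. *)
Definition enorm (x : 'rV[R]_I) : R := Num.sqrt (dot x x).

(* [bounded_set] refers to the sup norm, which has the same bounded sets as
   the Euclidean norm. *)
Definition locally_holder (gamma : R) (f : 'rV[R]_I -> R) : Prop :=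
  forall B : set 'rV[R]_I, bounded_set B ->
  exists C : R, forall x y, B x -> B y ->
    `|f x - f y| <= C * enorm (x - y) `^ gamma.

End euclidean.

Section probability_notions.
Context {R : realType} {d} {T : measurableType d} (P : probability T R).

Definition has_law {d'} {T' : measurableType d'} (X : T -> T')
    (mu : set T' -> \bar R) : Prop :=
  forall A, measurable A -> P (X @^-1` A) = mu A.

Definition mutually_independent (J : choiceType) (D : set J)
    (X : J -> {RV P >-> R}) : Prop :=
  forall (s : seq J) (B : J -> set R), uniq s -> [set` s] `<=` D ->
    (forall j, measurable (B j)) ->
    P (\bigcap_(j in [set` s]) X j @^-1` B j) =
    (\prod_(j <- s) P (X j @^-1` B j))%E.

Definition sigma_family (J : choiceType) (D : set J)
    (X : J -> {RV P >-> R}) : set (set T) :=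
  <<s \bigcup_(j in D) preimage_set_system setT (X j) measurable >>.

Definition independent_families (J K : choiceType) (D : set J) (E : set K)
    (X : J -> {RV P >-> R}) (Y : K -> {RV P >-> R}) : Prop :=
  forall A B, sigma_family D X A -> sigma_family E Y B ->
    P (A `&` B) = (P A * P B)%E.

Definition iid_normal (J : choiceType) (D : set J) (s : R)
    (X : J -> {RV P >-> R}) : Prop :=
  mutually_independent D X /\ forall j, D j -> has_law (X j) (normal_prob 0 s).

Definition version {S : Type} (Z Z' : S -> {RV P >-> R}) : Prop :=
  forall x, P [set w | Z' x w = Z x w] = 1%E.

Definition as_lipschitz {I : nat} (F : 'rV[R]_I -> T -> R) : Prop :=
  exists H : {RV P >-> R},
    {ae P, forall w, forall x y, `|F x w - F y w| <= H w * enorm (x - y)}.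

End probability_notions.

Section mvnormal.
Context {R : realType}.

(* [normal_prob] lives on [measurableTypeR R], which is [R] with the same Borel
   sets under another display. *)
Definition tcons (k : nat) (p : measurableTypeR R * k.-tuple R) :
  k.+1.-tuple R := [the k.+1.-tuple R of p.1 :: p.2].

Lemma measurable_tcons k : measurable_fun setT (@tcons k).
Proof.
apply: (@measurable_cons _ _ _ R (fst : measurableTypeR R * k.-tuple R -> R)) => //.
Qed.

HB.instance Definition _ k :=
  isMeasurableFun.Build _ _ _ _ (@tcons k) (@measurable_tcons k).

(* k-fold product of N(0, 1) *)
Fixpoint std_normal (k : nat) : probability (k.-tuple R) R :=
  if k is k'.+1 then
    distribution (normal_prob (0 : R) 1 \x std_normal k')%E (@tcons k')
  else \d_([tuple] : 0.-tuple R).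

Definition lin_tuple (k : nat) (A : 'M[R]_k) (g : k.-tuple R) : k.-tuple R :=
  [tuple \sum_(j < k) A r j * tnth g j | r < k].

Lemma measurable_lin_tuple k (A : 'M[R]_k) :
  measurable_fun setT (lin_tuple A).
Proof.
apply/measurable_fun_tnthP => r.
rewrite (_ : _ \o _ = fun g => \sum_(j < k) A r j * tnth g j); last first.
  by apply/funext => g /=; rewrite tnth_mktuple.
apply: measurable_sum => j.
by apply: measurable_funM => //; exact: measurable_tnth.
Qed.

HB.instance Definition _ k (A : 'M[R]_k) :=
  isMeasurableFun.Build _ _ _ _ (lin_tuple A) (measurable_lin_tuple A).

(* Some A with A A^T = Sigma; one exists iff Sigma is symmetric positive
   semidefinite. *)
Definition mxfactor (k : nat) (Sigma : 'M[R]_k) : 'M[R]_k :=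
  xget 0 [set A : 'M[R]_k | A *m A^T = Sigma].

(* N_k(0, Sigma), as the law of A g with g standard normal and A A^T = Sigma;
   this law does not depend on A, and Sigma may be singular. *)
Definition mvnormal (k : nat) (Sigma : 'M[R]_k) : probability (k.-tuple R) R :=
  distribution (std_normal k) (lin_tuple (mxfactor Sigma)).

End mvnormal.

(* In what follows layers and units are numbered from 1, and the inputs of a
   layer-1 unit are numbered 1, ..., I; values outside these ranges are junk. *)

Section network.
Context {R : realType} {d} {T : measurableType d} (P : probability T R).
Context (I : nat) (sw sb : R) (phi : R -> R).
Context (omega : nat -> nat -> nat -> {RV P >-> R}).
Context (b : nat -> nat -> {RV P >-> R}).

(* [omega l i j] is the weight of layer l from unit j to unit i, and [b l i]
   the bias of unit i of layer l. *)
Definition weight_dom : set (nat * nat * nat) :=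
  [set p | let: (l, i, j) := p in
    [/\ (1 <= l)%N, (1 <= i)%N, (1 <= j)%N & l = 1%N -> (j <= I)%N]].

Definition bias_dom : set (nat * nat) :=
  [set p | (1 <= p.1)%N /\ (1 <= p.2)%N].

Definition gaussian_params : Prop :=
  let w (p : nat * nat * nat) := omega p.1.1 p.1.2 p.2 in
  let c (p : nat * nat) := b p.1 p.2 in
  [/\ iid_normal weight_dom sw w,
      iid_normal bias_dom sb c &
      independent_families weight_dom bias_dom w c].

Fixpoint network (l i n : nat) (x : 'rV[R]_I) (w : T) : R :=
  match l with
  | 0 => 0
  | 1 => \sum_(j < I) omega 1 i j.+1 w * x 0 j + b 1 i w
  | l'.+1 =>
      (Num.sqrt n%:R)^-1 *
        \sum_(1 <= j < n.+1) omega l i j w * phi (network l' j n x w)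
      + b l i w
  end.

End network.

Section limit.
Context {R : realType} (I : nat) (sw sb : R) (phi : R -> R).

Fixpoint limit_cov (l k : nat) (x : 'I_k -> 'rV[R]_I) : 'M[R]_k :=
  match l with
  | 0 => 0
  | 1 => \matrix_(r, s) (sb ^+ 2 + sw ^+ 2 * dot (x r) (x s))
  | l'.+1 => \matrix_(r, s) (sb ^+ 2 + sw ^+ 2 *
      \int[mvnormal (limit_cov l' x)]_u (phi (tnth u r) * phi (tnth u s)))
  end.

(* The limiting process is specified through its finite-dimensional
   distributions, which do not depend on the unit. *)
Definition limit_process {d} {T : measurableType d} (P : probability T R)
    (l : nat) (Z : 'rV[R]_I -> {RV P >-> R}) : Prop :=
  forall (k : nat) (x : 'I_k -> 'rV[R]_I),
    has_law P (fun w => [tuple Z (x r) w | r < k]) (mvnormal (limit_cov l x)).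

End limit.

(* Main.v *)
Require Import Defs.
From HB Require Import structures.
From mathcomp Require Import all_boot all_order all_algebra.
From mathcomp Require Import all_classical all_reals all_analysis.
From mathcomp Require Import measurable_realfun zify ring lra.

Set Implicit Arguments.
Unset Strict Implicit.
Unset Printing Implicit Defensive.

Import Order.TTheory GRing.Theory Num.Theory.
Import numFieldNormedType.Exports.

Local Open Scope classical_set_scope.
Local Open Scope ring_scope.

(* The network is Lipschitz for every outcome, with a constant obtained layer by
   layer from the absolute values of the weights.

   For the limit, two-point increments are Gaussian with variance
   S_rr - 2 S_rs + S_ss, which from one layer to the next is
   sw^2 E (phi u_r - phi u_s)^2 <= sw^2 L^2 E (u_r - u_s)^2; inductively it is
   at most a constant times |x - y|^2, whence E (Z x - Z y)^(2m) <= C_m |x - y|^(2m)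
   for every m. Kolmogorov's chaining argument applies: almost surely, for every
   m, increments of Z over neighbouring level-n dyadic points of a cube are
   O(2^(-n (1 - (2I+1)/(2m)))), so Z' x, the limit of Z along the dyadic
   roundings of x, is locally gamma-Hoelder for all gamma < 1, and Z' x = Z x a.s.
   by the moment bound with m = 1. *)

Lemma exprn_double_ge0 {R : realType} (m : nat) (x : R) : 0 <= x ^+ m.*2.
Proof. by rewrite -mul2n exprM exprn_ge0// sqr_ge0. Qed.

Lemma exprn_double_norm {R : realType} (m : nat) (x : R) :
  `|x| ^+ m.*2 = x ^+ m.*2.
Proof. by rewrite -mul2n !exprM real_normK// num_real. Qed.

Lemma dot_ge0 {R : realType} {I : nat} (x : 'rV[R]_I) : 0 <= dot x x.
Proof. by rewrite sumr_ge0// => j _; rewrite -expr2 sqr_ge0. Qed.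

(** * Gaussian moments *)

Lemma expr_le_expR {R : realType} (m : nat) (y : R) :
  0 <= y -> y ^+ m <= m`!%:R * expR y.
Proof.
case: m => [|m] y0; first by rewrite expr0 fact0 mul1r -expR0 ler_expR.
rewrite mulrC -ler_pdivrMr ?ltr0n ?fact_gt0//.
by apply: le_trans (expR_ge1Dxn m y0); rewrite lerDr.
Qed.

Lemma ge0_integral_normal_prob {R : realType} (m s : R) (f : R -> \bar R) :
  measurable_fun setT f -> (forall x, 0 <= f x)%E ->
  (\int[normal_prob m s]_x f x =
   \int[lebesgue_measure]_x (f x * (normal_pdf m s x)%:E))%E.
Proof.
move=> mf f0.
have nu_mu := normal_prob_dominates m s.
rewrite -(Radon_Nikodym_SigmaFinite.change_of_variables nu_mu)//.
have mpdf : measurable_fun setT (EFin \o normal_pdf m s).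
  by apply/measurable_EFinP; exact: measurable_normal_pdf.
have irn := Radon_Nikodym_SigmaFinite.f_integrable nu_mu.
apply: ae_eq_integral => //.
- by apply: emeasurable_funM => //; exact: measurable_int irn.
- exact: emeasurable_funM.
- have : ae_eq lebesgue_measure setT
      (Radon_Nikodym_SigmaFinite.f (normal_prob m s) lebesgue_measure)
      (EFin \o normal_pdf m s).
    apply: integral_ae_eq => // A _ mA.
    by rewrite -(Radon_Nikodym_SigmaFinite.f_integral nu_mu mA).
  by apply: filterS => x + _ => /(_ I) /= ->.
Qed.

Lemma normal_moment_lty {R : realType} (m : nat) :
  (\int[normal_prob (0 : R) 1]_x (x ^+ m.*2)%:E < +oo)%E.
Proof.
have mX : measurable_fun setT (fun x : R => x ^+ m.*2) by exact: measurable_funX.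
have X0 := @exprn_double_ge0 R m.
rewrite ge0_integral_normal_prob; [|exact/measurable_EFinP|by move=> x; rewrite lee_fin].
pose K : R := (8 / 3) ^+ m * m`!%:R * normal_peak 1 / normal_peak 2.
have pk (s : R) : s != 0 -> 0 < normal_peak s by exact: normal_peak_gt0.
have K0 : 0 <= K.
  by rewrite /K divr_ge0 ?mulr_ge0 ?exprn_ge0 ?normal_peak_ge0// divr_ge0.
apply: (@le_lt_trans _ _
    (\int[lebesgue_measure]_x (K%:E * (normal_pdf 0 2 x)%:E)))%E; last first.
  rewrite ge0_integralZl_EFin//.
  - by rewrite integral_normal_pdf mule1 ltry.
  - by move=> x _; rewrite lee_fin normal_pdf_ge0.
  - by apply/measurable_EFinP; exact: measurable_normal_pdf.
apply: ge0_le_integral => //.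
- by move=> x _; rewrite mule_ge0// lee_fin// normal_pdf_ge0.
- by apply: emeasurable_funM; apply/measurable_EFinP => //; exact: measurable_normal_pdf.
- by apply: emeasurable_funM => //; apply/measurable_EFinP; exact: measurable_normal_pdf.
move=> x _; rewrite -!EFinM lee_fin !normal_pdfE//.
rewrite /normal_fun subr0.
set y := 3 / 8 * x ^+ 2.
have y0 : 0 <= y by rewrite mulr_ge0// sqr_ge0.
have -> : x ^+ m.*2 = (8 / 3) ^+ m * y ^+ m.
  by rewrite -mul2n exprM -exprMn /y mulrA; congr (_ ^+ _); field.
have -> : expR (- x ^+ 2 / (2 ^+ 2 *+ 2)) = expR y * expR (- x ^+ 2 / (1 ^+ 2 *+ 2)).
  by rewrite -expRD; congr expR; rewrite /y; field.
have -> : K * (normal_peak 2 * (expR y * expR (- x ^+ 2 / (1 ^+ 2 *+ 2)))) =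
  (8 / 3) ^+ m * (m`!%:R * expR y) * (normal_peak 1 * expR (- x ^+ 2 / (1 ^+ 2 *+ 2))).
  by rewrite /K; field; rewrite gt_eqF// pk.
rewrite ler_wpM2r ?mulr_ge0 ?normal_peak_ge0 ?expR_ge0//.
by rewrite ler_wpM2l ?exprn_ge0// expr_le_expR.
Qed.

Lemma exprn_sum_le {R : realType} (k m : nat) (t : 'I_k.+1 -> R) :
  (\sum_j t j) ^+ m.*2 <= k.+1%:R ^+ m.*2 * \sum_j t j ^+ m.*2.
Proof.
pose i0 := [arg max_(i > ord0 | true) `|t i|]%O.
have i0P j : `|t j| <= `|t i0|.
  by rewrite /i0; case: arg_maxP => //= i _; exact.
apply: (@le_trans _ _ (k.+1%:R ^+ m.*2 * t i0 ^+ m.*2)); last first.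
  rewrite ler_wpM2l ?exprn_ge0// (bigD1 i0)//= lerDl sumr_ge0// => j _.
  exact: exprn_double_ge0.
rewrite -exprn_double_norm -[X in _ <= _ * X]exprn_double_norm -exprMn.
rewrite lerXn2r ?nnegrE ?mulr_ge0//.
apply: (le_trans (ler_norm_sum _ _ _)).
apply: (le_trans (ler_sum _ (fun j _ => i0P j))).
by rewrite sumr_const card_ord mulr_natl.
Qed.

Section std_normal_moments.
Context {R : realType}.

Lemma std_normal_moment_lty (k m : nat) (j : 'I_k) :
  (\int[std_normal k]_g (tnth g j ^+ m.*2 : R)%:E < +oo)%E.
Proof.
have even_ge0 := @exprn_double_ge0 R m.
elim: k j => [[]//|k IH] j.
have mt n (i : 'I_n) : measurable_fun setT (fun g : n.-tuple R => (tnth g i ^+ m.*2)%:E).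
  apply/measurable_EFinP; exact: (measurable_funX _ (measurable_tnth _)).
rewrite /= ge0_integral_distribution//; last 2 first.
- exact: mt.
- by move=> g; rewrite lee_fin.
rewrite fubini_tonelli1//=; last 2 first.
- exact: (measurableT_comp (mt _ j) (@measurable_tcons R k)).
- by move=> p; rewrite lee_fin.
rewrite /fubini_F; case: (unliftP ord0 j) => [i ->|->].
- rewrite (eq_integral (cst (\int[std_normal k]_g (tnth g i ^+ m.*2)%:E)))%E.
    by rewrite integral_cst// [X in (_ * X)%E](probability_setT (normal_prob (0 : R) 1)) mule1 IH.
  move=> x _; apply: eq_integral => g _; congr ((_ ^+ _)%:E).
  by rewrite !(tnth_nth 0).
- rewrite (eq_integral (fun x : measurableTypeR R => ((x : R) ^+ m.*2)%:E)).
    exact: normal_moment_lty.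
  move=> x _; rewrite (eq_integral (cst ((x : R) ^+ m.*2)%:E)).
    by rewrite integral_cst// [X in (_ * X)%E](probability_setT (std_normal k)) mule1.
  by move=> g _; rewrite /= (tnth_nth 0).
Qed.

Lemma linear_form_moment (k m : nat) : exists2 C : R, 0 <= C &
  forall a : 'rV[R]_k.+1,
  (\int[std_normal k.+1]_g ((\sum_j a 0 j * tnth g j) ^+ m.*2)%:E <=
   (C * dot a a ^+ m)%:E)%E.
Proof.
have even_ge0 := @exprn_double_ge0 R m.
pose M (j : 'I_k.+1) := (\int[std_normal k.+1]_g (tnth g j ^+ m.*2 : R)%:E)%E.
have M0 j : (0 <= M j)%E by apply: integral_ge0 => g _; rewrite lee_fin.
have Mfin j : M j \is a fin_num by rewrite ge0_fin_numE// std_normal_moment_lty.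
have mt (i : 'I_k.+1) : measurable_fun setT (fun g : k.+1.-tuple R => tnth g i ^+ m.*2).
  exact: (measurable_funX _ (measurable_tnth _)).
exists (k.+1%:R ^+ m.*2 * \sum_j fine (M j)).
  by rewrite mulr_ge0// sumr_ge0// => j _; rewrite fine_ge0.
move=> a.
set c := k.+1%:R ^+ m.*2 * dot a a ^+ m.
have a0 := dot_ge0 a.
have c0 : 0 <= c by rewrite mulr_ge0// exprn_ge0.
apply: (@le_trans _ _ (\int[std_normal k.+1]_g
    (c%:E * \sum_j (tnth g j ^+ m.*2)%:E)))%E.
  apply: ge0_le_integral => //.
  - by move=> g _; rewrite lee_fin.
  - apply/measurable_EFinP; apply: measurable_funX.
    apply: measurable_sum => j; apply: measurable_funM => //; exact: measurable_tnth.
  - apply: measurable_funeM.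
    by apply: emeasurable_sum => j; exact/measurable_EFinP.
  move=> g _; rewrite sumEFin -EFinM lee_fin (le_trans (exprn_sum_le _ _))//.
  rewrite -mulrA ler_wpM2l// mulr_sumr ler_sum// => j _.
  rewrite exprMn ler_wpM2r// -mul2n exprM lerXn2r ?nnegrE ?sqr_ge0//.
  by rewrite expr2 /dot (bigD1 j)//= lerDl sumr_ge0// => i _; rewrite -expr2 sqr_ge0.
rewrite ge0_integralZl_EFin//; last 2 first.
- by move=> g _; rewrite sume_ge0// => j _; rewrite lee_fin.
- by apply: emeasurable_sum => j; exact/measurable_EFinP.
rewrite ge0_integral_sum//; last 2 first.
- by move=> j; exact/measurable_EFinP.
- by move=> j g _; rewrite lee_fin.
rewrite (eq_bigr (fun j => (fine (M j))%:E)); last by move=> j _; rewrite fineK.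
by rewrite sumEFin -EFinM lee_fin /c mulrAC.
Qed.

Lemma mvnormal_moment (k m : nat) : exists2 C : R, 0 <= C &
  forall (S : 'M[R]_k.+1) (c : 'rV[R]_k.+1),
  (\int[mvnormal S]_u ((\sum_r c 0 r * tnth u r) ^+ m.*2)%:E <=
   (C * dot (c *m mxfactor S) (c *m mxfactor S) ^+ m)%:E)%E.
Proof.
have [C C0 CP] := linear_form_moment k m; exists C => // S c; set a := c *m _.
rewrite /mvnormal ge0_integral_distribution//=; last 2 first.
- apply/measurable_EFinP; apply: measurable_funX.
  apply: measurable_sum => j; apply: measurable_funM => //; exact: measurable_tnth.
- by move=> u; rewrite lee_fin -mul2n exprM exprn_ge0// sqr_ge0.
apply: le_trans (CP a); rewrite le_eqVlt; apply/orP; left; apply/eqP.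
apply: eq_integral => g _ /=; congr ((_ ^+ _)%:E).
under eq_bigr do rewrite tnth_mktuple mulr_sumr.
rewrite exchange_big /=; apply: eq_bigr => j _; rewrite /a mxE mulr_suml.
by apply: eq_bigr => r _; rewrite mulrA.
Qed.

End std_normal_moments.

(** * Increments of the limiting process *)

Lemma lipschitz_bound {R : realType} (phi : R -> R) : lipschitz phi ->
  exists2 L, 0 <= L & forall x y, `|phi x - phi y| <= L * `|x - y|.
Proof.
move=> /pinfty_ex_gt0[L L0 HL]; exists L; first exact: ltW.
by move=> x y; apply: (HL (x, y)).
Qed.

Section square_integrable.
Context {R : realType} {d} {T : measurableType d} (mu : probability T R).

Definition sqr_integrable (U : T -> R) : Prop :=
  measurable_fun setT U /\ mu.-integrable setT (fun w => (U w ^+ 2)%:E).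

Lemma sqr_integrable_lty (U : T -> R) : measurable_fun setT U ->
  (\int[mu]_w (U w ^+ 2)%:E < +oo)%E -> sqr_integrable U.
Proof.
move=> mU foo; split=> //; apply/integrableP; split.
  exact/measurable_EFinP/measurable_funX.
under eq_integral do rewrite gee0_abs ?lee_fin ?sqr_ge0//.
exact: foo.
Qed.

Lemma sqr_integrableM (U V : T -> R) : sqr_integrable U -> sqr_integrable V ->
  mu.-integrable setT (EFin \o (fun w => U w * V w)).
Proof.
move=> [mU iU] [mV iV].
apply: (le_integrable measurableT _ _ (integrableD measurableT iU iV)).
  by apply/measurable_EFinP; exact: measurable_funM.
move=> w _ /=; rewrite lee_fin normrM.
rewrite [X in _ <= X]ger0_norm ?addr_ge0 ?sqr_ge0//.
rewrite -(real_normK (num_real (U w))) -(real_normK (num_real (V w))).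
have := sqr_ge0 (`|U w| - `|V w|).
have := mulr_ge0 (normr_ge0 (U w)) (normr_ge0 (V w)).
nra.
Qed.

Lemma sqr_integrable_lipschitz (phi : R -> R) (L : R) (U : T -> R) :
  continuous phi -> 0 <= L -> (forall x y, `|phi x - phi y| <= L * `|x - y|) ->
  sqr_integrable U -> sqr_integrable (phi \o U).
Proof.
move=> cphi L0 HL [mU iU].
have mphi : measurable_fun setT (phi \o U).
  by apply: measurableT_comp => //; exact: continuous_measurable_fun.
split=> //.
pose a := 2 * phi 0 ^+ 2; pose c := 2 * L ^+ 2.
have ia : mu.-integrable setT (cst a%:E).
  exact: finite_measure_integrable_cst.
have := integrableD measurableT ia (integrableZl measurableT c iU).
apply: le_integrable => //.
  by apply/measurable_EFinP; exact: measurable_funX.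
move=> w _; rewrite /= lee_fin.
rewrite ger0_norm ?sqr_ge0// [X in _ <= X]ger0_norm; last first.
  by rewrite /a /c addr_ge0// mulr_ge0 ?sqr_ge0// mulr_ge0 ?sqr_ge0.
have := HL (U w) 0; rewrite subr0 => h.
have : (phi (U w) - phi 0) ^+ 2 <= L ^+ 2 * U w ^+ 2.
  rewrite -exprMn -(real_normK (num_real (phi _ - _))).
  rewrite -(real_normK (num_real (L * _))) normrM (ger0_norm L0).
  by rewrite lerXn2r ?nnegrE// mulr_ge0.
have := sqr_ge0 (phi (U w) - 2 * phi 0).
rewrite /a /c; nra.
Qed.

Lemma Rintegral_sqrB (U V : T -> R) : sqr_integrable U -> sqr_integrable V ->
  \int[mu]_w (U w - V w) ^+ 2 =
  \int[mu]_w (U w * U w) - \int[mu]_w (U w * V w)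
  - (\int[mu]_w (V w * U w) - \int[mu]_w (V w * V w)).
Proof.
move=> iU iV; have iM := sqr_integrableM.
have iB W1 W2 W3 : sqr_integrable W1 -> sqr_integrable W2 -> sqr_integrable W3 ->
    mu.-integrable setT (EFin \o (fun w => W1 w * W2 w - W1 w * W3 w)).
  move=> i1 i2 i3.
  exact: (integrableB measurableT (iM _ _ i1 i2) (iM _ _ i1 i3)).
rewrite -!RintegralB//; try exact: iM; try exact: iB.
by apply: eq_Rintegral => w _; ring.
Qed.

End square_integrable.

Section limit_increments.
Context {R : realType} (I : nat) (sw sb : R) (phi : R -> R).

(* Variance of [u_r - u_s] under [mvnormal S]. *)
Definition increment_var (k : nat) (S : 'M[R]_k) (r s : 'I_k) : R :=
  let a := (delta_mx 0 r - delta_mx 0 s) *m mxfactor S in dot a a.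

(* The value 0 occurs when S has no factor, i.e. when [mxfactor S] is junk; so
   positive semidefiniteness of the limit covariances is not needed. *)
Lemma increment_varE (k : nat) (S : 'M[R]_k) (r s : 'I_k) :
  increment_var S r s = 0 \/
  increment_var S r s = S r r - S r s - (S s r - S s s).
Proof.
rewrite /increment_var /mxfactor; case: xgetP => [A _ /= AS|_]; last first.
  by left; rewrite mulmx0 /dot big1// => j _; rewrite mxE mulr0.
right; rewrite -AS.
rewrite mulmxBl -!rowE /dot !mxE -!sumrB; apply: eq_bigr => j _.
by rewrite !mxE; ring.
Qed.

Lemma sum_delta (k : nat) (r s : 'I_k) (u : k.-tuple R) :
  \sum_t (delta_mx 0 r - delta_mx 0 s : 'rV[R]_k) 0 t * tnth u t =
  tnth u r - tnth u s.
Proof.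
under eq_bigr do rewrite !mxE mulrBl !eqxx /=.
rewrite sumrB (bigD1 r)//= eqxx mul1r big1 ?addr0; last first.
  by move=> i /negbTE ->; rewrite mul0r.
rewrite (bigD1 s)//= eqxx mul1r big1 ?addr0// => i /negbTE ->.
by rewrite mul0r.
Qed.

Lemma mvnormal_sqr_integrable (k : nat) (S : 'M[R]_k.+1) (r : 'I_k.+1) :
  sqr_integrable (mvnormal S) (fun u => tnth u r).
Proof.
apply: sqr_integrable_lty; first exact: measurable_tnth.
have [C _ /(_ S (delta_mx 0 r)) HC] := @mvnormal_moment R k 1.
apply: le_lt_trans (ltry _); apply: le_trans HC.
rewrite le_eqVlt; apply/orP; left; apply/eqP; apply: eq_integral => u _.
rewrite (bigD1 r)//= mxE !eqxx mul1r big1 ?addr0//.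
by move=> i /negbTE ir; rewrite mxE ir andbF mul0r.
Qed.

Lemma limit_cov_increment (k l : nat) : continuous phi -> lipschitz phi ->
  exists2 C : R, 0 <= C & forall (x : 'I_k.+1 -> 'rV[R]_I) (r s : 'I_k.+1),
    increment_var (limit_cov sw sb phi l.+1 x) r s <= C * dot (x r - x s) (x r - x s).
Proof.
move=> cphi /lipschitz_bound[L L0 HL].
elim: l => [|l [C C0 HC]].
  exists (sw ^+ 2); first exact: sqr_ge0.
  move=> x r s; have [->|->] := increment_varE (limit_cov sw sb phi 1 x) r s.
    by apply: mulr_ge0; [exact: sqr_ge0|exact: dot_ge0].
  rewrite !mxE le_eqVlt; apply/orP; left; apply/eqP.
  have dotBl (u v z : 'rV[R]_I) : dot (u - v) z = dot u z - dot v z.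
    by rewrite /dot -sumrB; apply: eq_bigr => j _; rewrite !mxE mulrBl.
  have dotC (u v : 'rV[R]_I) : dot u v = dot v u.
    by apply: eq_bigr => j _; rewrite mulrC.
  rewrite [in RHS]dotBl ![dot _ (x r - x s)]dotC !dotBl (dotC (x s) (x r)).
  by ring.
have [D D0 HD] := @mvnormal_moment R k 1.
have K0 : 0 <= sw ^+ 2 * L ^+ 2 * D * C.
  by apply: mulr_ge0 => //; apply: mulr_ge0 => //; apply: mulr_ge0; exact: sqr_ge0.
exists (sw ^+ 2 * L ^+ 2 * D * C) => //.
move=> x r s.
have [->|->] := increment_varE (limit_cov sw sb phi l.+2 x) r s.
  by rewrite mulr_ge0// dot_ge0.
rewrite ![limit_cov _ _ _ l.+2 _ _ _]mxE -/(limit_cov sw sb phi l.+1 x).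
set S := limit_cov sw sb phi l.+1 x.
have iu t : sqr_integrable (mvnormal S) (fun u => phi (tnth u t)).
  exact: (sqr_integrable_lipschitz cphi L0 HL (mvnormal_sqr_integrable S t)).
set q := \int[mvnormal S]_u (phi (tnth u r) - phi (tnth u s)) ^+ 2.
apply: (@le_trans _ _ (sw ^+ 2 * q)).
  by rewrite /q Rintegral_sqrB// le_eqVlt; apply/orP; left; apply/eqP; ring.
rewrite -3!(mulrA (sw ^+ 2)) -2!(mulrA (L ^+ 2)) -(mulrA D).
rewrite ler_wpM2l ?sqr_ge0//.
apply: (@le_trans _ _ (L ^+ 2 * (D * increment_var S r s))); last first.
  by rewrite ler_wpM2l ?sqr_ge0// ler_wpM2l// HC.
have mt i : measurable_fun setT (fun u : k.+1.-tuple R => tnth u i).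
  exact: measurable_tnth.
have := HD S (delta_mx 0 r - delta_mx 0 s); rewrite expr1 => HDS.
have q_le : (\int[mvnormal S]_u ((phi (tnth u r) - phi (tnth u s)) ^+ 2)%:E <=
    (L ^+ 2 * (D * increment_var S r s))%:E)%E.
  rewrite EFinM; apply: le_trans; last first.
    by apply: lee_wpmul2l HDS; rewrite lee_fin sqr_ge0.
  rewrite -ge0_integralZl_EFin ?sqr_ge0//; last 2 first.
  - by move=> u _; rewrite lee_fin sqr_ge0.
  - apply/measurable_EFinP; apply: measurable_funX.
    by apply: measurable_sum => j; exact: measurable_funM.
  apply: ge0_le_integral => //.
  - by move=> u _; rewrite lee_fin sqr_ge0.
  - apply/measurable_EFinP; apply: measurable_funX.
    by apply: measurable_funB; [have [] := iu r | have [] := iu s].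
  - apply: measurable_funeM; apply/measurable_EFinP; apply: measurable_funX.
    by apply: measurable_sum => j; exact: measurable_funM.
  move=> u _; rewrite -EFinM lee_fin sum_delta -exprMn.
  rewrite -(real_normK (num_real (phi _ - _))).
  rewrite -(real_normK (num_real (L * _))) normrM (ger0_norm L0).
  by rewrite lerXn2r ?nnegrE// mulr_ge0.
rewrite /q /Rintegral -lee_fin fineK//.
rewrite ge0_fin_numE; first exact: le_lt_trans q_le (ltry _).
by apply: integral_ge0 => u _; rewrite lee_fin sqr_ge0.
Qed.

End limit_increments.

Lemma limit_process_moment {R : realType} (I : nat) (sw sb : R) (phi : R -> R)
    {d} {T : measurableType d} (P : probability T R) (l : nat)
    (Z : 'rV[R]_I -> {RV P >-> R}) (m : nat) :
  continuous phi -> lipschitz phi -> limit_process sw sb phi l.+1 Z ->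
  exists2 C : R, 0 <= C & forall x y,
    (\int[P]_w ((Z x w - Z y w) ^+ m.*2)%:E <= (C * dot (x - y) (x - y) ^+ m)%:E)%E.
Proof.
move=> cphi lphi limZ.
have [C C0 HC] := limit_cov_increment I sw sb 1 l cphi lphi.
have [D D0 HD] := @mvnormal_moment R 1 m.
exists (D * C ^+ m); first by rewrite mulr_ge0// exprn_ge0.
move=> x y.
pose p (r : 'I_2) := if r == ord0 then x else y.
set S := limit_cov sw sb phi l.+1 p.
pose X w : 2.-tuple R := [tuple Z (p r) w | r < 2].
have mX : measurable_fun setT X.
  apply/measurable_fun_tnthP => r.
  rewrite (_ : _ \o _ = Z (p r)) => //.
  by apply/funext => w /=; rewrite tnth_mktuple.
have mf : measurable_fun setT
    (fun u : 2.-tuple R => ((tnth u ord0 - tnth u ord_max) ^+ m.*2)%:E).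
  apply/measurable_EFinP; apply: measurable_funX.
  by apply: measurable_funB; exact: measurable_tnth.
have even_ge0 := @exprn_double_ge0 R m.
have dot_pos := @dot_ge0 R.
have -> : (\int[P]_w ((Z x w - Z y w) ^+ m.*2)%:E =
    \int[mvnormal S]_u ((tnth u ord0 - tnth u ord_max) ^+ m.*2)%:E)%E.
  rewrite -(@eq_measure_integral _ _ _ _ _ (pushforward P X)).
    rewrite ge0_integral_pushforward//; last by move=> u _; rewrite lee_fin.
    by apply: eq_integral => w _ /=; rewrite !tnth_mktuple.
  by move=> A mA _; exact: limZ.
have := HD S (delta_mx 0 ord0 - delta_mx 0 ord_max).
under eq_integral do rewrite sum_delta.
move/le_trans; apply; rewrite lee_fin -mulrA ler_wpM2l// -exprMn lerXn2r ?nnegrE//.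
  by rewrite mulr_ge0.
exact: HC.
Qed.

(** * Lipschitz constant of the network *)

Section euclidean_norm.
Context {R : realType} {I : nat}.
Implicit Types x y : 'rV[R]_I.

Lemma coord_le_enorm x j : `|x 0 j| <= enorm x.
Proof.
rewrite -sqrtr_sqr ler_wsqrtr// expr2 /dot (bigD1 j)//= lerDl.
by rewrite sumr_ge0// => i _; rewrite -expr2 sqr_ge0.
Qed.

Lemma dot_le x (e : R) : (forall j, `|x 0 j| <= e) -> dot x x <= I%:R * e ^+ 2.
Proof.
move=> xe; rewrite mulr_natl -[in leRHS](card_ord I) -sumr_const ler_sum// => j _.
rewrite -expr2 -real_normK ?num_real// lerXn2r ?nnegrE//.
exact: le_trans (xe j).
Qed.

Lemma coord_le_norm x j : `|x 0 j| <= `|x|.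
Proof.
rewrite [leRHS]mx_normrE.
exact: (le_bigmax _ (fun i : 'I_1 * 'I_I => `|x i.1 i.2|) (0, j)).
Qed.

Lemma norm_le_enorm x : `|x| <= enorm x.
Proof.
have [->|] := eqVneq x 0; first by rewrite normr0 sqrtr_ge0.
rewrite -normr_eq0 => /mx_norm_neq0[[i j] /= xE].
have -> : `|x| = `|x i j| by [].
by rewrite ord1 coord_le_enorm.
Qed.

Lemma enorm_le_norm x : enorm x <= Num.sqrt I%:R * `|x|.
Proof.
apply: (@le_trans _ _ (Num.sqrt (I%:R * `|x| ^+ 2))).
  by rewrite ler_wsqrtr// dot_le// => j; exact: coord_le_norm.
by rewrite sqrtrM// sqrtr_sqr normr_id.
Qed.

End euclidean_norm.

Section network_lipschitz.
Context {R : realType} {d} {T : measurableType d} (P : probability T R).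
Context (I : nat) (phi : R -> R).
Context (omega : nat -> nat -> nat -> {RV P >-> R}) (b : nat -> nat -> {RV P >-> R}).

Lemma network_lipschitz (l n i : nat) : lipschitz phi ->
  exists2 H : T -> R, measurable_fun setT H & forall w (x y : 'rV[R]_I),
    `|network phi omega b l.+1 i n x w - network phi omega b l.+1 i n y w|
      <= H w * enorm (x - y).
Proof.
move=> /lipschitz_bound[L L0 HL].
elim: l i => [|l IH] i.
  exists (fun w => \sum_(j < I) `|omega 1 i j.+1 w|).
    apply: measurable_sum => j; apply: measurableT_comp => //.
  move=> w x y /=; rewrite opprD addrACA subrr addr0 -sumrB mulr_suml.
  apply: le_trans (ler_norm_sum _ _ _) _; apply: ler_sum => j _.
  rewrite -mulrBr normrM ler_wpM2l//.
  by have := coord_le_enorm (x - y) j; rewrite !mxE.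
have [H mH HH] : exists2 H : nat -> T -> R, forall j, measurable_fun setT (H j) &
    forall j w (x y : 'rV[R]_I),
    `|network phi omega b l.+1 j n x w - network phi omega b l.+1 j n y w|
      <= H j w * enorm (x - y).
  have /choice[H HP] : forall j, exists H : T -> R, measurable_fun setT H /\
      forall w (x y : 'rV[R]_I),
      `|network phi omega b l.+1 j n x w - network phi omega b l.+1 j n y w|
        <= H w * enorm (x - y).
    by move=> j; have [H mH HH] := IH j; exists H.
  by exists H => j; have [] := HP j.
exists (fun w => (Num.sqrt n%:R)^-1 *
    \sum_(1 <= j < n.+1) `|omega l.+2 i j w| * (L * H j w)).
  apply: measurable_funM => //; apply: measurable_sum => j.
  apply: measurable_funM; first exact: measurableT_comp.
  exact: measurable_funM.
move=> w x y.
rewrite [network _ _ _ l.+2 _ _ x _]/= [network _ _ _ l.+2 _ _ y _]/=.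
rewrite -/(network phi omega b l.+1) opprD addrACA subrr addr0 -mulrBr normrM.
rewrite ger0_norm ?invr_ge0 ?sqrtr_ge0// -mulrA ler_wpM2l ?invr_ge0 ?sqrtr_ge0//.
rewrite -sumrB mulr_suml; apply: le_trans (ler_norm_sum _ _ _) _.
apply: ler_sum => j _; rewrite -mulrBr normrM -mulrA ler_wpM2l//.
by apply: le_trans (HL _ _) _; rewrite -mulrA ler_wpM2l// HH.
Qed.

End network_lipschitz.

(** * Kolmogorov's continuity theorem *)

Lemma ae_bounded_of_summable {R : realType} {d} {T : measurableType d}
    (P : probability T R) (Y : nat -> T -> R) (c : R) :
  (forall n, measurable_fun setT (Y n)) -> (forall n w, 0 <= Y n w) ->
  (forall n, \int[P]_w (Y n w)%:E <= (c / 2 ^+ n)%:E)%E ->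
  {ae P, forall w, exists2 M : R, 0 <= M & forall n, Y n w <= M}.
Proof.
move=> mY Y0 HY.
pose S w := (\sum_(n <oo) (Y n w)%:E)%E.
have S0 w : (0 <= S w)%E by apply: nneseries_ge0 => n _ _; rewrite lee_fin.
have mS : measurable_fun setT S.
  apply: ge0_emeasurable_sum => // [n w _ _|n _]; first by rewrite lee_fin.
  exact/measurable_EFinP.
have iS : P.-integrable setT S.
  apply/integrableP; split => //.
  under eq_integral do rewrite gee0_abs//.
  rewrite integral_nneseries//; last 2 first.
  - by move=> n; exact/measurable_EFinP.
  - by move=> n w _; rewrite lee_fin.
  apply: (@le_lt_trans _ _ (\sum_(k <oo) ((c * 2) / (2 ^ (k + 1))%:R)%:E)%E).
    apply: lee_nneseries => [n _ _|n _].
      by apply: integral_ge0 => w _; rewrite lee_fin.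
    apply: le_trans (HY n) _; rewrite lee_fin natrX exprD expr1 invfM.
    by rewrite le_eqVlt; apply/orP; left; apply/eqP; field; rewrite expf_neq0.
  rewrite (cvg_lim _ (@cvg_geometric_eseries_half R (c * 2) 0))//.
  by rewrite ltry.
have := integrable_ae measurableT iS.
apply: filterS => w /(_ I) Sfin; exists (fine (S w)); first exact: fine_ge0.
move=> n; rewrite -lee_fin fineK//.
apply: le_trans (@nneseries_lim_ge R (fun n => (Y n w)%:E) xpredT 0 n.+1 _).
  by rewrite big_mkord big_ord_recr /= leeDr// sume_ge0// => k _; rewrite lee_fin.
by move=> k _ _; rewrite lee_fin.
Qed.

Lemma geometric_cauchy {R : realType} (u : nat -> R) (M q : R) :
  0 <= M -> 0 <= q -> q < 1 -> (forall n, `|u n.+1 - u n| <= M * q ^+ n) ->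
  cvgn u /\ forall n, `|limn u - u n| <= M / (1 - q) * q ^+ n.
Proof.
move=> M0 q0 q1 Hu.
have q1' : 0 < 1 - q by rewrite subr_gt0.
have A0 : 0 <= M / (1 - q) by rewrite divr_ge0// ltW.
have tail n k : `|u (n + k)%N - u n| <= M / (1 - q) * q ^+ n.
  suff : `|u (n + k)%N - u n| <= M / (1 - q) * (q ^+ n - q ^+ (n + k)).
    by move/le_trans; apply; rewrite ler_wpM2l// lerBlDr lerDl exprn_ge0.
  elim: k => [|k IH]; first by rewrite addn0 !subrr normr0 mulr0.
  rewrite addnS -[u _.+1](subrK (u (n + k)%N)) -addrA.
  apply: (le_trans (ler_normD _ _)).
  apply: (le_trans (lerD (Hu _) IH)).
  rewrite le_eqVlt; apply/orP; left; apply/eqP.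
  by rewrite exprS; field; rewrite gt_eqF.
have cu : cvgn u.
  have cs : cvgn (series (fun n => u n.+1 - u n)).
    apply: normed_cvg; apply: (@series_le_cvg _ _ (geometric M q)) => //.
    - by move=> n /=.
    - by move=> n; exact: geometric_ge0.
    - by apply: is_cvg_geometric_series; rewrite ger0_norm.
  have -> : u = (fun n => u 0%N + series (fun n => u n.+1 - u n) n).
    by apply/funext => n; rewrite /series /= telescope_sumr// addrC subrK.
  by apply: is_cvgD => //; exact: is_cvg_cst.
split=> // n.
have cn : `|u k - u n| @[k --> \oo] --> `|limn u - u n|.
  by apply: cvg_norm; apply: cvgB => //; exact: cvg_cst.
rewrite -(cvg_lim _ cn)//; apply: limr_le; first by apply/cvg_ex; eexists; exact: cn.
near=> k; rewrite -(@subnKC n k); first exact: tail.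
by near: k; exact: nbhs_infty_ge.
Unshelve. all: by end_near. Qed.

Section dyadic.
Context {R : realType} {I : nat}.
Implicit Types (x y s t : 'rV[R]_I).

Definition cube (N : nat) : set 'rV[R]_I := [set x | forall j, `|x 0 j| <= N%:R].

Definition dyadic_pt (N n : nat) : set 'rV[R]_I :=
  [set s | forall j, `|s 0 j| <= N%:R /\ exists z : int, s 0 j = z%:~R / 2 ^+ n].

Definition dyadic (n : nat) x : 'rV[R]_I :=
  \row_j ((Num.floor (2 ^+ n * x 0 j))%:~R / 2 ^+ n).

Let p2_gt0 n : 0 < 2 ^+ n :> R. Proof. exact: exprn_gt0. Qed.

Lemma dyadic_itv n x j : x 0 j - (2 ^+ n)^-1 <= dyadic n x 0 j <= x 0 j.
Proof.
rewrite mxE ler_pdivrMr ?p2_gt0// [x 0 j * _]mulrC floor_le andbT.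
rewrite ler_pdivlMr ?p2_gt0// mulrBl mulVf ?gt_eqF ?p2_gt0//.
rewrite lerBlDr [x 0 j * _]mulrC.
by have /ltW := floorD1_gt (2 ^+ n * x 0 j); rewrite intrD.
Qed.

Lemma dyadic_ptP N n x : cube N x -> dyadic_pt N n (dyadic n x).
Proof.
move=> Nx j; split; last by rewrite mxE; eexists.
rewrite ler_norml; have /andP[_ xd] := dyadic_itv n x j.
move: (Nx j); rewrite ler_norml => /andP[Nx1 Nx2].
rewrite (le_trans xd Nx2) andbT mxE ler_pdivlMr ?p2_gt0//.
have -> : - N%:R * 2 ^+ n = (- (N * 2 ^ n)%:Z)%:~R :> R.
  by rewrite intrN -pmulrn natrM natrX mulNr.
rewrite ler_int floor_ge_int intrN -pmulrn natrM natrX -mulNr mulrC.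
by rewrite ler_pM2l.
Qed.

Lemma dyadic_ptS N n s : dyadic_pt N n s -> dyadic_pt N n.+1 s.
Proof.
move=> Ns j; have [sN [z sz]] := Ns j; split=> //.
exists (z * 2); rewrite sz intrM exprS; field.
by rewrite expf_neq0.
Qed.

Lemma dyadic_cvg_coord n x j : `|x 0 j - dyadic n x 0 j| <= (2 ^+ n)^-1.
Proof.
have /andP[d1 d2] := dyadic_itv n x j.
by rewrite ger0_norm ?subr_ge0// lerBlDr addrC -lerBlDr.
Qed.

(* With the factor [2 N + 1], the roundings at level n of two points at distance
   at most [2 N / 2 ^ n] are adjacent; at level 0 this covers the whole cube. *)
Definition adjacent (N n : nat) s t : Prop :=
  forall j, `|s 0 j - t 0 j| <= (2 * N + 1)%:R / 2 ^+ n.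

(* There are about [2 ^ (2 I n)] pairs of level-n points of a cube, and the mean
   of each [(f s - f t) ^+ m.*2] is of order [2 ^ - (n m.*2)]; one more factor
   [2 ^ n] is given up to make the sum over n converge. *)
Definition dyadic_increment_bound (N m : nat) (f : 'rV[R]_I -> R) : Prop :=
  exists2 W : R, 0 <= W & forall n s t,
    dyadic_pt N n s -> dyadic_pt N n t -> adjacent N n s t ->
    (f s - f t) ^+ m.*2 <= W / (2 ^+ n) ^+ (m.*2 - (2 * I).+1).

Lemma dyadic_chaining (f : 'rV[R]_I -> R) (N : nat) (M q : R) :
  (0 < N)%N -> 0 <= M -> 0 <= q -> q < 1 ->
  (forall n s t, dyadic_pt N n s -> dyadic_pt N n t -> adjacent N n s t ->
     `|f s - f t| <= M * q ^+ n) ->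
  let g x := limn (fun n => f (dyadic n x)) in
  (forall x, cube N x -> cvgn (fun n => f (dyadic n x))) /\
  exists2 A, 0 <= A & forall n x y, cube N x -> cube N y ->
    (forall j, `|x 0 j - y 0 j| <= (2 * N)%:R / 2 ^+ n) ->
    `|g x - g y| <= A * q ^+ n.
Proof.
move=> N0 M0 q0 q1 Hf g.
have step x : cube N x -> forall n,
    `|f (dyadic n.+1 x) - f (dyadic n x)| <= M * q ^+ n.
  move=> Nx n.
  apply: (@le_trans _ _ (M * q ^+ n.+1)); last first.
    by rewrite ler_wpM2l// exprS ler_piMl ?exprn_ge0// ltW.
  apply: Hf; [exact: dyadic_ptP|by apply: dyadic_ptS; exact: dyadic_ptP|].
  move=> j; have /andP[a1 a2] := dyadic_itv n.+1 x j.
  have /andP[b1 b2] := dyadic_itv n x j.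
  apply: (@le_trans _ _ ((2 ^+ n)^-1)).
    have := p2_gt0 n; rewrite -invr_gt0 => e0.
    have e1 : (2 ^+ n.+1)^-1 <= (2 ^+ n)^-1 :> R.
      by rewrite lef_pV2 ?posrE ?p2_gt0// ler_weXn2l ?ler1n.
    by rewrite ler_norml; apply/andP; split; lra.
  rewrite exprS invfM mulrA -[leLHS]mul1r ler_pM2r ?invr_gt0 ?p2_gt0//.
  rewrite ler_pdivlMr// mul1r.
  by rewrite -[2]/(2%:R) ler_nat; lia.
split; first by move=> x Nx; have [] := geometric_cauchy M0 q0 q1 (step x Nx).
have A0 : 0 <= M / (1 - q) by rewrite divr_ge0// subr_ge0 ltW.
exists (M + M / (1 - q) + M / (1 - q)); first by rewrite !addr_ge0.
move=> n x y Nx Ny xy.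
have [_ /(_ n) gx] := geometric_cauchy M0 q0 q1 (step x Nx).
have [_ /(_ n) gy] := geometric_cauchy M0 q0 q1 (step y Ny).
have fxy : `|f (dyadic n x) - f (dyadic n y)| <= M * q ^+ n.
  apply: Hf; [exact: dyadic_ptP|exact: dyadic_ptP|] => j.
  move: (xy j); rewrite natrD mulrDl mul1r.
  have /andP[a1 a2] := dyadic_itv n x j.
  have /andP[b1 b2] := dyadic_itv n y j.
  by rewrite !ler_norml => /andP[c1 c2]; apply/andP; split; lra.
rewrite !mulrDl; move: fxy gx gy.
rewrite -/(g x) -/(g y) !ler_norml => /andP[? ?] /andP[? ?] /andP[? ?].
by apply/andP; split; lra.
Qed.

End dyadic.

Lemma dyadic_scale {R : realType} (c e : R) : 0 < e -> e <= c ->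
  exists n, c / 2 ^+ n.+1 < e <= c / 2 ^+ n.
Proof.
move=> e0 ec; have p2 n : 0 < 2 ^+ n :> R by exact: exprn_gt0.
have ex : exists n, c / 2 ^+ n < e.
  exists (Num.truncn (c / e)).+1.
  rewrite ltr_pdivrMr// -ltr_pdivrMl// mulrC.
  apply: lt_trans (truncnS_gt _) _.
  by rewrite -natrX ltr_nat ltn_expl.
case: (ex_minnP ex) => -[|n] Hn min_n; first by rewrite expr0 divr1 ltNge ec in Hn.
exists n; rewrite Hn leNgt; apply/negP => /min_n.
by rewrite ltnn.
Qed.

Lemma locally_holder_continuous {R : realType} {I : nat} (gamma : R)
    (f : 'rV[R]_I -> R) : 0 < gamma -> locally_holder gamma f -> continuous f.
Proof.
move=> g0 hf x; have Fx := nbhs_filter x; apply/cvgrPdist_lt => e e0.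
have [C HC] : exists C, forall y, ball x 1 y -> `|f x - f y| <= C * enorm (x - y) `^ gamma.
  have [C HC] : exists C : R, forall u v, ball x 1 u -> ball x 1 v ->
      `|f u - f v| <= C * enorm (u - v) `^ gamma.
    apply: hf; exists (1 + `|x|); split; first exact: num_real.
    move=> M /ltW xM y; rewrite /= -ball_normE /= => xy; apply: le_trans xM.
    rewrite -[y](subrK x) (le_trans (ler_normD _ _))// lerD2r distrC.
    exact: ltW.
  by exists C => y xy; apply: HC => //; exact: ballxx.
pose K := `|C| + 1; have K0 : 0 < K by rewrite ltr_wpDl.
pose r := (e / K) `^ gamma^-1.
have r0 : 0 < r by apply: powR_gt0; exact: divr_gt0.
pose s : R := Num.sqrt I%:R + 1; have s0 : 0 < s by rewrite ltr_wpDl ?sqrtr_ge0.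
have min0 : 0 < Num.min 1 (r / s) by rewrite lt_min ltr01 divr_gt0.
have := nbhsx_ballx x _ min0; apply: filterS => y.
rewrite -ball_normE /= lt_min => /andP[y1 yr].
have {y1}/HC HCy : ball x 1 y by rewrite -ball_normE.
have er : enorm (x - y) <= r.
  apply: le_trans (enorm_le_norm _) _.
  move: yr; rewrite ltr_pdivlMr// => /ltW; apply: le_trans.
  by rewrite mulrC ler_wpM2l// /s lerDl.
apply: (le_lt_trans HCy); apply: (@le_lt_trans _ _ (`|C| * (e / K))); last first.
  by rewrite mulrCA gtr_pMr// ltr_pdivrMr// mul1r /K ltrDl.
apply: (le_trans (ler_norm _)); rewrite normrM ler_wpM2l//.
rewrite ger0_norm ?powR_ge0//.
have -> : e / K = r `^ gamma.
  by rewrite /r -powRrM mulVf ?gt_eqF// powRr1// divr_ge0// ltW.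
by rewrite ge0_ler_powR ?nnegrE ?sqrtr_ge0// ltW.
Qed.

Lemma increments_locally_holder {R : realType} {I : nat} (f : 'rV[R]_I -> R) :
  (forall N m, (2 * I < m.*2)%N -> dyadic_increment_bound N m f) ->
  forall gamma : R, 0 < gamma -> gamma < 1 ->
  (forall x, cvgn (fun n => f (dyadic n x))) /\
  locally_holder gamma (fun x => limn (fun n => f (dyadic n x))).
Proof.
move=> Hf gamma g0 g1.
pose m := (Num.truncn ((2 * I).+1%:R / (1 - gamma))).+1.
have g1' : 0 < 1 - gamma by rewrite subr_gt0.
have mg : (2 * I).+1%:R < m%:R * (1 - gamma) by rewrite -ltr_pdivrMr// truncnS_gt.
have Im : (2 * I < m)%N.
  rewrite -(ltr_nat R); apply: (@le_lt_trans _ _ (2 * I).+1%:R); first by rewrite ler_nat.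
  by apply: (lt_le_trans mg); rewrite ler_piMr// lerBlDr lerDl ltW.
have Im2 : (2 * I < m.*2)%N by rewrite (leq_trans Im)// -addnn leq_addr.
set e := (m.*2 - (2 * I).+1)%N.
have eg : gamma * m.*2%:R <= e%:R.
  rewrite natrB// -mul2n natrM; have m0 : 0 <= m%:R * (1 - gamma) by rewrite mulr_ge0// ltW.
  by move: mg m0; lra.
pose q : R := 2^-1 `^ gamma.
have q0 : 0 <= q by exact: powR_ge0.
have q1 : q < 1.
  have -> : 1 = 1 `^ gamma :> R by rewrite powR1.
  apply: gt0_ltr_powR => //; rewrite ?nnegrE//.
  by rewrite invf_lt1// ltr1n.
have qn n : q ^+ n = ((2 ^+ n)^-1) `^ gamma.
  by rewrite /q -powR_mulrn ?powR_ge0// -powRrM mulrC powRrM powR_mulrn// exprVn.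
have qe : (2 ^+ e)^-1 <= q ^+ m.*2.
  rewrite -powR_mulrn// /q -powRrM -exprVn -powR_mulrn//.
  by apply: ger_powR => //; rewrite invr_gt0 ltr0n /= invf_le1// ler1n.
have key N : exists2 M, 0 <= M & forall n s t,
    dyadic_pt N n s -> dyadic_pt N n t -> adjacent N n s t ->
    `|f s - f t| <= M * q ^+ n.
  have [W W0 HW] := Hf N m Im2; exists (1 + W); first by rewrite addr_ge0.
  move=> n s t Ns Nt st.
  have Mq0 : 0 <= (1 + W) * q ^+ n by rewrite mulr_ge0 ?addr_ge0 ?exprn_ge0.
  rewrite -(@ler_pXn2r _ m.*2) ?nnegrE// ?double_gt0//.
  rewrite exprn_double_norm; apply: (le_trans (HW n s t Ns Nt st)).
  rewrite exprMn; apply: ler_pM => //.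
  - apply: (@le_trans _ _ (1 + W)); first by rewrite lerDr.
    by rewrite -[leLHS]expr1 ler_weXn2l ?lerDl// double_gt0.
  - rewrite -!exprM ![(n * _)%N]mulnC [in leLHS]exprM -exprVn exprM.
    by rewrite lerXn2r ?nnegrE ?invr_ge0 ?exprn_ge0.
have chain N := let: ex_intro2 _ M0 HM := key N.+1 in
  dyadic_chaining (ltn0Sn N) M0 q0 q1 HM.
split.
  move=> x; have [+ _] := chain (Num.truncn `|x|); apply.
  move=> j; apply: le_trans (coord_le_norm x j) _.
  exact/ltW/truncnS_gt.
move=> B /pinfty_ex_gt0[M M0 BM].
have [_ [A A0 HA]] := chain (Num.truncn M).
set N := (Num.truncn M).+1 in HA.
have BN x : B x -> cube N x.
  move=> Bx j; apply: le_trans (coord_le_norm x j) _.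
  by apply: le_trans (BM _ Bx) _; exact/ltW/truncnS_gt.
exists A => x y Bx By.
have [->|xy] := eqVneq x y; first by rewrite subrr normr0 mulr_ge0// powR_ge0.
have d0 : 0 < `|x - y| by rewrite normr_gt0 subr_eq0.
have dN : `|x - y| <= (2 * N)%:R.
  rewrite (le_trans (ler_normB _ _))// mul2n -addnn natrD lerD//.
    by apply: le_trans (BM _ Bx) _; exact/ltW/truncnS_gt.
  by apply: le_trans (BM _ By) _; exact/ltW/truncnS_gt.
have [n /andP[n1 n2]] := dyadic_scale d0 dN.
apply: (le_trans (HA n x y (BN x Bx) (BN y By) _)).
  by move=> j; apply: le_trans n2; have := coord_le_norm (x - y) j; rewrite !mxE.
rewrite ler_wpM2l// qn ge0_ler_powR ?(ltW g0)// ?nnegrE ?invr_ge0 ?exprn_ge0 ?sqrtr_ge0//.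
apply: le_trans (norm_le_enorm _); apply: le_trans (ltW n1).
rewrite natrM exprS invfM mulrACA divff// mul1r ler_peMl ?invr_ge0 ?exprn_ge0//.
by rewrite ler1n.
Qed.

Section kolmogorov.
Context {R : realType} {I : nat} {d} {T : measurableType d} (P : probability T R).
Variable Z : 'rV[R]_I -> {RV P >-> R}.

Definition lipschitz_moments : Prop := forall m : nat,
  exists2 C : R, 0 <= C & forall x y,
    (\int[P]_w ((Z x w - Z y w) ^+ m.*2)%:E <= (C * dot (x - y) (x - y) ^+ m)%:E)%E.

Hypothesis HZ : lipschitz_moments.

Let grid_index (N n : nat) := {ffun 'I_I -> 'I_(2 * N * 2 ^ n).+1}.

Let grid_pt (N n : nat) (a : grid_index N n) : 'rV[R]_I :=
  \row_j ((a j)%:R / 2 ^+ n - N%:R).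

Let grid_ptP N n s : dyadic_pt N n s -> exists a : grid_index N n, s = grid_pt a.
Proof.
move=> Ns.
have /choice[k kP] : forall j, exists k : 'I_(2 * N * 2 ^ n).+1,
    s 0 j = k%:R / 2 ^+ n - N%:R.
  move=> j; have [+ [z sz]] := Ns j.
  have p2 : 0 < 2 ^+ n :> R by exact: exprn_gt0.
  rewrite sz ler_norml ler_pdivlMr// ler_pdivrMr// => /andP[z1 z2].
  have {}z1 : - (N * 2 ^ n)%:Z <= z.
    by rewrite -(ler_int R) intrN -pmulrn natrM natrX -mulNr.
  have {}z2 : z <= (N * 2 ^ n)%:Z.
    by rewrite -(ler_int R) -pmulrn natrM natrX.
  have kE : (absz (z + (N * 2 ^ n)%:Z))%:Z = z + (N * 2 ^ n)%:Z.
    by rewrite gez0_abs// -lerBlDr sub0r.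
  have kl : (absz (z + (N * 2 ^ n)%:Z)%R < (2 * N * 2 ^ n).+1)%N.
    by rewrite ltnS -mulnA; move: (N * 2 ^ n)%N kE z1 z2 => q; lia.
  have kR : (absz (z + (N * 2 ^ n)%:Z))%:R = z%:~R + N%:R * 2 ^+ n :> R.
    by rewrite [LHS]pmulrn kE intrD -pmulrn natrM natrX.
  exists (Ordinal kl); rewrite /= kR.
  by field; rewrite gt_eqF.
exists (finfun k); apply/rowP => j; rewrite mxE ffunE.
exact: kP.
Qed.

Let measurable_increment m x y :
  measurable_fun setT (fun w => (Z x w - Z y w) ^+ m.*2).
Proof. by apply: measurable_funX; exact: measurable_funB. Qed.

Lemma ae_dyadic_increments (N m : nat) : (2 * I < m.*2)%N ->
  {ae P, forall w, dyadic_increment_bound N m (fun x => Z x w)}.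
Proof.
move=> Im; have [C C0 HC] := HZ m.
have even_ge0 := @exprn_double_ge0 R m.
set e := (m.*2 - (2 * I).+1)%N.
have em : m.*2 = (e + (2 * I).+1)%N by rewrite /e; lia.
pose B : R := (2 * N).+1%:R.
pose h n (p : grid_index N n * grid_index N n) w : R :=
  if `[< adjacent N n (grid_pt p.1) (grid_pt p.2) >]
  then (Z (grid_pt p.1) w - Z (grid_pt p.2) w) ^+ m.*2 else 0.
have h0 n p w : 0 <= h n p w by rewrite /h; case: ifP.
have mh n p : measurable_fun setT (h n p) by rewrite /h; case: asbool.
pose Y n w := (2 ^+ n) ^+ e * \sum_p h n p w.
have p2 n : 0 < 2 ^+ n :> R by exact: exprn_gt0.
have B0 : 0 <= B by rewrite ler0n.
have K0 n : 0 <= I%:R * (B / 2 ^+ n) ^+ 2.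
  by apply: mulr_ge0 => //; apply: exprn_ge0; rewrite divr_ge0// exprn_ge0.
have hint n p : (\int[P]_w (h n p w)%:E <= (C * (I%:R * (B / 2 ^+ n) ^+ 2) ^+ m)%:E)%E.
  rewrite /h; case: asboolP => [adj|_]; last first.
    by rewrite integral0 lee_fin; apply: mulr_ge0 => //; exact: exprn_ge0.
  apply: le_trans (HC _ _) _; rewrite lee_fin ler_wpM2l// lerXn2r ?nnegrE ?dot_ge0//.
  apply: dot_le => j; rewrite mxE [X in _ + X]mxE.
  by have -> : B = (2 * N + 1)%:R by rewrite addn1.
have : {ae P, forall w, exists2 M : R, 0 <= M & forall n, Y n w <= M}.
  apply: (@ae_bounded_of_summable _ _ _ _ _ (B ^+ (2 * I) * C * (I%:R * B ^+ 2) ^+ m)).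
  - by move=> n; apply: measurable_funM => //; apply: measurable_sum.
  - by move=> n w; apply: mulr_ge0; rewrite ?sumr_ge0// !exprn_ge0.
  move=> n; rewrite /Y.
  under eq_integral do rewrite EFinM -sumEFin.
  rewrite ge0_integralZl_EFin ?exprn_ge0//; last 2 first.
  - by move=> w _; rewrite sume_ge0// => p _; rewrite lee_fin.
  - by apply: emeasurable_sum => p; apply/measurable_EFinP.
  rewrite ge0_integral_sum//; last 2 first.
  - by move=> p; apply/measurable_EFinP.
  - by move=> p w _; rewrite lee_fin.
  have card_le : #|{: grid_index N n * grid_index N n}|%:R <= ((B * 2 ^+ n) ^+ (2 * I) : R).
    rewrite card_prod card_ffun !card_ord mulnn -expnM (mulnC I) natrX.
    rewrite lerXn2r ?nnegrE ?mulr_ge0 ?exprn_ge0//.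
    by rewrite -natrX -natrM ler_nat mulSn -[X in (X <= _)%N]add1n leq_add2r expn_gt0.
  apply: (@le_trans _ _ (((2 ^+ n) ^+ e)%:E *
    (\sum_(p : grid_index N n * grid_index N n)
       C * (I%:R * (B / 2 ^+ n) ^+ 2) ^+ m)%:E)%E).
    by rewrite lee_wpmul2l ?lee_fin ?exprn_ge0// -sumEFin lee_sum// => p _.
  rewrite -EFinM lee_fin sumr_const -(mulr_natl (C * _)).
  set t : R := 2 ^+ n; have t0 : t != 0 by rewrite gt_eqF// p2.
  have te0 : 0 <= t ^+ e by rewrite exprn_ge0// ltW// p2.
  apply: (@le_trans _ _ (t ^+ e * ((B * t) ^+ (2 * I) *
      (C * (I%:R * (B / t) ^+ 2) ^+ m)))).
    by rewrite ler_wpM2l// ler_wpM2r// mulr_ge0// exprn_ge0// K0.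
  have -> : (I%:R * (B / t) ^+ 2) ^+ m = (I%:R * B ^+ 2) ^+ m / (t ^+ e * t ^+ (2 * I) * t).
    rewrite expr_div_n mulrA expr_div_n -(exprM t 2) mul2n em exprD.
    by rewrite [t ^+ (2 * I).+1]exprSr mulrA.
  rewrite exprMn le_eqVlt; apply/orP; left; apply/eqP; field.
  by rewrite t0 !expf_neq0.
apply: filterS => w [W W0 HW]; exists W => // n s t Ns Nt adj.
have [a sa] := grid_ptP Ns; have [c tc] := grid_ptP Nt.
rewrite ler_pdivlMr ?exprn_gt0// mulrC; apply: le_trans (HW n).
rewrite /Y ler_wpM2l ?exprn_ge0// (bigD1 (a, c))//=.
by rewrite {1}/h /= -sa -tc asboolT// lerDl sumr_ge0.
Qed.

Lemma ae_cvg_dyadic x : {ae P, forall w, Z (dyadic n x) w @[n --> \oo] --> Z x w}.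
Proof.
have [C C0 HC] := HZ 1.
pose Y n w := 2 ^+ n * (Z (dyadic n x) w - Z x w) ^+ 2.
have p2 n : 0 < 2 ^+ n :> R by exact: exprn_gt0.
have : {ae P, forall w, exists2 M : R, 0 <= M & forall n, Y n w <= M}.
  apply: (@ae_bounded_of_summable _ _ _ _ _ (C * I%:R)).
  - by move=> n; apply: measurable_funM => //; exact: measurable_increment 1 _ _.
  - by move=> n w; apply: mulr_ge0; [exact: ltW|exact: sqr_ge0].
  move=> n; rewrite /Y.
  under eq_integral do rewrite EFinM.
  rewrite ge0_integralZl_EFin ?exprn_ge0//; last 2 first.
  - by move=> w _; rewrite lee_fin sqr_ge0.
  - by apply/measurable_EFinP; exact: measurable_increment 1 _ _.
  apply: (@le_trans _ _ ((2 ^+ n)%:E * (C * (I%:R * ((2 ^+ n)^-1) ^+ 2))%:E)%E).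
    rewrite lee_wpmul2l ?lee_fin ?exprn_ge0//.
    apply: le_trans (HC _ _) _; rewrite lee_fin expr1 ler_wpM2l//.
    apply: dot_le => j; rewrite mxE [X in _ + X]mxE distrC.
    exact: dyadic_cvg_coord.
  rewrite -EFinM lee_fin le_eqVlt; apply/orP; left; apply/eqP; field.
  by rewrite gt_eqF.
apply: filterS => w [W W0 HW].
pose D n := Z (dyadic n x) w - Z x w.
have D2 : (D n) ^+ 2 @[n --> \oo] --> (0 : R).
  apply: (@squeeze_cvgr _ _ _ _ (fun=> 0) (geometric W 2^-1)).
  - near=> n; rewrite sqr_ge0 /=.
    have := HW n; rewrite /Y mulrC -ler_pdivlMr// => /le_trans; apply.
    by rewrite exprVn.
  - exact: cvg_cst.
  - by apply: cvg_geometric; rewrite ger0_norm ?invr_ge0// invf_lt1// ltr1n.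
have : Num.sqrt ((D n) ^+ 2) @[n --> \oo] --> Num.sqrt (0 : R).
  by apply: continuous_cvg => //; exact: sqrt_continuous.
rewrite sqrtr0; under eq_fun do rewrite sqrtr_sqr.
by move/norm_cvg0P; rewrite /D => /subr_cvg0.
Unshelve. all: by end_near. Qed.

(* The upper limit makes every [limit_version x] measurable, also where the limit
   does not exist. *)
Let limit_version x w : R :=
  fine (limn_esup (fun n => (Z (dyadic n x) w)%:E)).

Let measurable_limit_version x : measurable_fun setT (limit_version x).
Proof.
apply: measurableT_comp => //; apply: measurable_fun_limn_esup => n.
exact/measurable_EFinP.
Qed.

Let limit_versionE x w (a : R) : Z (dyadic n x) w @[n --> \oo] --> a ->
  limit_version x w = a.
Proof.
move=> za.
have zaE : (Z (dyadic n x) w)%:E @[n --> \oo] --> a%:E.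
  by apply: cvg_EFin => //; exact: nearW.
by rewrite /limit_version (cvg_limn_einf_sup zaE).2.
Qed.

Lemma kolmogorov_continuity :
  exists2 Z' : 'rV[R]_I -> {RV P >-> R}, version Z Z' &
    {ae P, forall w, forall gamma : R, 0 < gamma -> gamma < 1 ->
      locally_holder gamma (fun x => Z' x w)}.
Proof.
pose Z' x : {RV P >-> R} := mfun_Sub (mem_set (measurable_limit_version x)).
exists Z'.
  move=> x.
  have mE : measurable [set w | Z' x w = Z x w].
    rewrite (_ : mkset _ = (fun w => Z' x w - Z x w) @^-1` [set 0]).
      rewrite -[X in measurable X]setTI.
      by apply: measurable_funB => //; exact: measurable_set1.
    apply/seteqP; split=> w /=; first by move=> ->; rewrite subrr.
    by move/eqP; rewrite subr_eq0 => /eqP.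
  have Z'0 : P (~` [set w | Z' x w = Z x w]) = 0%E.
    apply/negligibleP; first exact: measurableC.
    have := ae_cvg_dyadic x.
    by apply: filterS => w; exact: limit_versionE.
  by rewrite -[[set w | _]]setCK probability_setC ?Z'0 ?sube0//; exact: measurableC.
have : {ae P, forall w, forall N m, (2 * I < m.*2)%N -> dyadic_increment_bound N m (fun x => Z x w)}.
  apply: ae_foralln => N; apply: ae_foralln => m.
  have [Im|_] := boolP (2 * I < m.*2)%N; last exact: aeW.
  by have := ae_dyadic_increments N Im; apply: filterS => w.
apply: filterS => w Hw gamma g0 g1.
have [cvgZ holderZ] := increments_locally_holder Hw g0 g1.
rewrite (_ : (fun x => _) = fun x => limn (fun n => Z (dyadic n x) w))//.
by apply/funext => x; exact: limit_versionE (cvgZ x).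
Qed.

End kolmogorov.

Theorem lemma2 (R : realType) (d d' : measure_display)
    (T : measurableType d) (P : probability T R)
    (T' : measurableType d') (P' : probability T' R)
    (I : nat) (sw sb : R) (phi : R -> R)
    (omega : nat -> nat -> nat -> {RV P >-> R})
    (b : nat -> nat -> {RV P >-> R}) (l i : nat) :
  0 < sw -> 0 < sb -> continuous phi ->
  gaussian_params I sw sb omega b ->
  (2 <= l)%N -> (1 <= i)%N ->
  lipschitz phi ->
  (forall n, (1 <= n)%N ->
     as_lipschitz P (fun (x : 'rV[R]_I) w => network phi omega b l i n x w)) /\
  (forall Z : 'rV[R]_I -> {RV P' >-> R},
     limit_process sw sb phi l Z ->
     exists2 Z' : 'rV[R]_I -> {RV P' >-> R}, version Z Z' &
       {ae P', forall w, continuous (fun x : 'rV[R]_I => Z' x w) /\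
          forall gamma : R, 0 < gamma -> gamma < 1 ->
            locally_holder gamma (fun x : 'rV[R]_I => Z' x w)}).
Proof.
move=> _ _ cphi _ + _ lphi; case: l => // -[//|l] _; split.
  move=> n _.
  have [H mH HH] := @network_lipschitz R d T P I phi omega b l.+1 n i lphi.
  by exists (mfun_Sub (mem_set mH)); apply: aeW => w x y; exact: HH.
move=> Z limZ.
have HZ : lipschitz_moments Z.
  by move=> m; exact: limit_process_moment cphi lphi limZ.
have [Z' ZZ' aeZ'] := kolmogorov_continuity HZ.
exists Z' => //; apply: filterS aeZ' => w hw; split=> //.
have h0 : 0 < 2^-1 :> R by lra.
have h1 : 2^-1 < 1 :> R by lra.
exact: locally_holder_continuous h0 (hw _ h0 h1).
Qed.
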